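(* Let $h\ge 0$ and $m\ge 3$, and let $(G,D)$ be a finite $3$-transposition group of type $4^{\bullet h}\operatorname{SU}_m(2)'$. Then the diagram of $(G,D)$ has size $$n=4^{h}\,(2^{2m-1}-1-(-2)^{m-1})/3$$ and spectrum $$((\,2^{2m-3+2h};\ [-(-2)^{m-3+2h}]^{d},\ [-(-2)^{m-2+2h}]^{e},\ [0]^{\star}\,)),$$ where $d=8(2^{2m-3}-1-(-2)^{m-2})/9$ and $e=4(2^{2m-3}-1-7(-2)^{m-3})/9$.
   Context: A $3$-transposition group $(G,D)$ is a group $G$ generated by a conjugacy class $D$ of elements of order $2$ such that $|de|\in\{1,2,3\}$ for all $d,e\in D$. Its diagram is the graph with vertex set $D$ in which two elements are adjacent iff their product has order $3$; its size is $n=|D|$. The spectrum is that of the $(0,1)$-adjacency matrix, written $((k;\dots,[r]^c,\dots))$: first the degree $k$ of the (regular) diagram, counted once, then the remaining eigenvalues, $[r]^c$ meaning $r$ with multiplicity $c$; if listed values coincide, their multiplicities are added, and $[r]^\star$ means that $r$ has whatever further multiplicity (possibly zero) is required for the total multiplicity to be $n$. $\operatorname{SU}_m(2)$ is the special unitary group of a nondegenerate hermitian form $f$ on $\mathbb{F}_4^m$; its derived group $\operatorname{SU}_m(2)'$ (equal to $\operatorname{SU}_m(2)$ for $m\ge4$) is generated by the $3$-transposition class $E$ of unitary transvections $x\mapsto x+f(x,v)v$ with $v\neq0$ isotropic. Two $3$-transposition groups have the same central type if their quotients by their centers are isomorphic as $3$-transposition groups (matching the images of the generating classes). $(G,D)$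 has type $4^{\bullet h}\operatorname{SU}_m(2)'$ if $G$ has a normal $2$-subgroup $N$ with $|D\cap dN|=4^{h}$ for all $d\in D$ and $(G/N,DN/N)$ has the same central type as $(\operatorname{SU}_m(2)',E)$. (The extension may be split or not.) *)

(* Defs.v *)
From HB Require Import structures.
From mathcomp Require Import all_boot all_order all_algebra all_fingroup.
From mathcomp Require Import all_solvable all_field.
Set Implicit Arguments.
Unset Strict Implicit.
Unset Printing Implicit Defensive.
Import GRing.Theory.
Local Open Scope ring_scope.

Definition three_transposition_group (gT : finGroupType) (G : {group gT})
    (D : {set gT}) : Prop :=
  [/\ D \in classes G, <<D>>%g = G,
      {in D, forall x, #[x]%g = 2%N}
    & {in D &, forall x y, #[x * y]%g \in [:: 1; 2; 3]%N}].

Definition diagram (gT : finGroupType) : rel gT :=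
  fun x y => #[x * y]%g == 3%N.

Definition diagram_degree (gT : finGroupType) (D : {set gT}) (x : gT) : nat :=
  #|[set y in D | diagram x y]|.

Definition adjacency_mx (gT : finGroupType) (D : {set gT}) : 'M[algC]_#|D| :=
  \matrix_(i, j) (diagram (enum_val i) (enum_val j))%:R.

(* The eigenvalues, listed with algebraic multiplicity; only meaningful up to
   perm_eq. *)
Definition spectrum n (A : 'M[algC]_n) : seq algC :=
  sval (closed_field_poly_normal (char_poly A)).

(* That the two pairs are 3-transposition groups is not built in. *)
Definition same_central_type (gT hT : finGroupType)
    (G : {group gT}) (D : {set gT}) (H : {group hT}) (E : {set hT}) : Prop :=
  exists phi : {morphism (G / 'Z(G))%g >-> coset_of 'Z(H)%g},
    isom (G / 'Z(G)) (H / 'Z(H)) phi /\ (phi @* (D / 'Z(G)) = E / 'Z(H))%g.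

Fact pchar_card4 (F : finFieldType) : #|F| = 4%N -> 2%N \in [pchar F].
Proof. by move=> cardF; apply: (@card_finPcharP F 2 2). Qed.

(* The involutory automorphism a |-> a ^+ 2 of a field of order 4. *)
Notation conj4 cardF := (pFrobenius_aut (pchar_card4 cardF)).

(* {'GL_m[F]} consists of matrices of size m.-1.+1, which is m for m > 0. They
   act on row vectors from the right. *)
Section SpecialUnitary.

Variables (F : finFieldType) (cardF : #|F| = 4%N) (m : nat).
Variable f : {hermitian 'rV[F]_m.-1.+1 for false & conj4 cardF}.

Definition SU : {set {'GL_m[F]}} :=
  [set g : {'GL_m[F]} | (\det (GLval g) == 1) &&
     [forall x : 'rV[F]_m.-1.+1, forall y : 'rV[F]_m.-1.+1,
        f (x *m GLval g) (y *m GLval g) == f x y]].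

Fact SU_group_set : group_set SU.
Proof.
apply/group_setP; split=> [|g h].
  rewrite inE GL_1E det1 eqxx /=.
  by apply/forallP=> x; apply/forallP=> y; rewrite !mulmx1.
rewrite !inE => /andP[/eqP dg /forallP fg] /andP[/eqP dh /forallP fh].
rewrite GL_MxE det_mulmx dg dh mulr1 eqxx /=.
apply/forallP=> x; apply/forallP=> y; rewrite !mulmxA.
by rewrite (eqP (forallP (fh _) _)) (eqP (forallP (fg _) _)).
Qed.

Canonical SU_group := Group SU_group_set.

Definition unitary_transvections : {set {'GL_m[F]}} :=
  [set g : {'GL_m[F]} | [exists v : 'rV[F]_m.-1.+1,
     [&& v != 0, f v v == 0
       & [forall x : 'rV[F]_m.-1.+1, x *m GLval g == x + f x v *: v]]]].

Definition type_4h_SU (h : nat) (gT : finGroupType) (G : {group gT})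
    (D : {set gT}) : Prop :=
  exists N : {group gT},
    [/\ (N <| G)%g, (2%N.-group N)%g,
        {in D, forall x, #|D :&: (x *: N)%g| = (4 ^ h)%N}
      & same_central_type (G / N)%G (D / N)%g
          (SU_group^`(1)%g)%G unitary_transvections].

End SpecialUnitary.

(* Main.v *)
Require Import Defs.
From HB Require Import structures.
From mathcomp Require Import all_boot all_order all_algebra all_fingroup.
From mathcomp Require Import all_solvable all_field.
From mathcomp Require Import ring lra zify.
Set Implicit Arguments.
Unset Strict Implicit.
Unset Printing Implicit Defensive.
Import Order.TTheory GRing.Theory Num.Theory.
Local Open Scope ring_scope.

(* The map from D to the quotient of SU_m(2)' by its center labels every x in D
   by an isotropic point, each point being used 4 ^ h times, in such a way that
   |xy| = 3 iff the labels of x and y are not orthogonal.  No two distinct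
   elements of D or of the class of transvections get identified in a central
   quotient: if x and xz are involutions with z central, and y is such that xy
   and xzy both have order 3, then z ^ 2 = z ^ 3 = 1.

   The diagram is thus a blow-up of the non-orthogonality graph on isotropic
   points, whose common neighbors are counted with the sums of (-1) ^ f(w, w).
   The sum S over all w satisfies S ^ 2 = 4 ^ m, and S = 1 modulo 3 because
   scalars act freely on nonzero vectors, so that S = (-2) ^ m.  With
   rho = - (-2) ^ (m - 3) and q = 4 ^ h, the adjacency matrix B of the diagram
   satisfies B ^ 3 = 2 (rho q) ^ 2 B - rho q B ^ 2 + c J, which yields its
   eigenvalues, and the traces of its powers yield their multiplicities. *)

Lemma natr_negb (b : bool) : (~~ b)%:R = 1 - b%:R :> rat.
Proof. by case: b; rewrite ?subrr ?subr0. Qed.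

(** * Hermitian forms over the field of order 4 *)

Section HermitianF4.

Variables (F : finFieldType) (cardF : #|F| = 4%N) (n : nat).
Variable f : {hermitian 'rV[F]_n.+1 for false & conj4 cardF}.
Implicit Types (a b c t : F) (u v w x : 'rV[F]_n.+1).

Lemma F4_addrr a : a + a = 0.
Proof. by rewrite -mulr2n -mulr_natl (pcharf0 (pchar_card4 cardF)) mul0r. Qed.

Lemma F4_expr4 a : a ^+ 4 = a.
Proof. by rewrite -{1}cardF expf_card. Qed.

Lemma F4_expr3 a : a != 0 -> a ^+ 3 = 1.
Proof. by move=> a0; apply: (mulfI a0); rewrite -exprS F4_expr4 mulr1. Qed.

Lemma F4_sqrD a b : (a + b) ^+ 2 = a ^+ 2 + b ^+ 2.
Proof. by rewrite sqrrD mulr2n F4_addrr addr0. Qed.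

Lemma F4_idem a : a ^+ 2 = a -> (a == 0) || (a == 1).
Proof.
move=> /eqP; rewrite expr2 -subr_eq0 -{3}[a]mulr1 -mulrBr mulf_eq0.
by rewrite subr_eq0.
Qed.

Lemma hermC4 u v : f u v = f v u ^+ 2.
Proof. by rewrite hermC /= mul1r pFrobenius_autE. Qed.

Lemma hermC0 u v : (f u v == 0) = (f v u == 0).
Proof. by rewrite hermC4 expf_eq0. Qed.

Lemma hermDl u v w : f (u + v) w = f u w + f v w.
Proof. exact: linearDl. Qed.

Lemma hermDr u v w : f w (u + v) = f w u + f w v.
Proof. exact: linearDr. Qed.

Lemma hermBr u v w : f w (u - v) = f w u - f w v.
Proof. exact: linearBr. Qed.

Lemma hermZl a u v : f (a *: u) v = a * f u v.
Proof. exact: linearZl_LR. Qed.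

Lemma hermZr a u v : f u (a *: v) = a ^+ 2 * f u v.
Proof. by rewrite linearZr_LR /= pFrobenius_autE. Qed.

Lemma herm0l v : f 0 v = 0.
Proof. by rewrite -(scale0r 0) hermZl mul0r. Qed.

Lemma herm0r v : f v 0 = 0.
Proof. by rewrite hermC4 herm0l expr0n. Qed.

Lemma herm_idem v : f v v ^+ 2 = f v v.
Proof. by rewrite -hermC4. Qed.

Lemma hermZ_eq0l a u v : a != 0 -> (f (a *: u) v == 0) = (f u v == 0).
Proof. by move=> a0; rewrite hermZl mulf_eq0 (negPf a0). Qed.

Lemma hermZ_eq0r a u v : a != 0 -> (f u (a *: v) == 0) = (f u v == 0).
Proof. by move=> a0; rewrite hermZr mulf_eq0 expf_eq0 (negPf a0). Qed.

Lemma hermZZ a u : a != 0 -> f (a *: u) (a *: u) = f u u.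
Proof. by move=> a0; rewrite hermZl hermZr mulrA -exprS F4_expr3 // mul1r. Qed.

(** The last summand is the trace of [f u w] to the prime field. *)
Lemma herm_self_shift u w :
  f (w + u) (w + u) = f w w + f u u + (f u w + f u w ^+ 2).
Proof. by rewrite hermDl !hermDr -(hermC4 w u); ring. Qed.

(* The nontrivial additive character of F_2, on the prime field of F. *)
Definition sgF a : rat := if a == 0 then 1 else -1.

Lemma sgFD a b : a ^+ 2 = a -> b ^+ 2 = b -> sgF (a + b) = sgF a * sgF b.
Proof.
move=> /F4_idem + /F4_idem.
case/orP=> /eqP-> /orP[] /eqP->; rewrite /sgF ?addr0 ?add0r ?F4_addrr;
  by rewrite ?eqxx ?oner_eq0 ?mulr1 ?mul1r ?mulrNN.
Qed.

Lemma F4_trace_idem t : (t + t ^+ 2) ^+ 2 = t + t ^+ 2.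
Proof. by rewrite F4_sqrD -exprM F4_expr4 addrC. Qed.

(** After rescaling by [a], the trace [c + c ^+ 2] vanishes exactly at 0 and 1, so that two of the
    four signs are positive and two are negative. *)
Lemma sum_sgF_trace a : a != 0 -> \sum_c sgF (c * a + (c * a) ^+ 2) = 0.
Proof.
move=> a0; rewrite (reindex_onto (fun c => c / a) (fun c => c * a)) /=; last first.
  by move=> c _; rewrite mulfK.
rewrite (eq_bigl xpredT) => [|c]; last by rewrite mulfVK ?eqxx.
rewrite (eq_bigr (fun c => sgF (c + c ^+ 2))) => [|c _]; last by rewrite mulfVK.
rewrite (bigD1 0) //= (bigD1 1) ?oner_eq0 //=.
rewrite (eq_bigr (fun=> -1)) => [|c /andP[c0 c1]]; last first.
  rewrite /sgF -{1}[c]mulr1 expr2 -mulrDr mulf_eq0 (negPf c0) /=.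
  case: eqP => // /eqP; rewrite addr_eq0 -[- c]addr0 -(F4_addrr c) addKr.
  by rewrite eq_sym (negPf c1).
rewrite sumr_const.
have -> : #|[pred i : F | (i != 0) && (i != 1)]| = 2%N.
  have := cardC (pred2 (0 : F) 1).
  rewrite card2 [0 == 1]eq_sym oner_eq0 cardF => /(@addnI 2 _ 2) card2C.
  by apply: etrans card2C; apply: eq_card => c; rewrite !inE negb_or.
by rewrite /sgF !expr0n !expr1n /= addr0 F4_addrr eqxx.
Qed.


(** * Character sums along lines *)

Definition chi w : rat := sgF (f w w).

Lemma sgF_indicator a : a ^+ 2 = a -> 2 * (a == 0)%:R = 1 + sgF a.
Proof. by move=> /F4_idem/orP[] /eqP->; rewrite /sgF ?eqxx ?oner_eq0 //=; lra. Qed.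

Lemma isotropic_indicator w : 2 * (f w w == 0)%:R = 1 + chi w.
Proof. exact/sgF_indicator/herm_idem. Qed.

Lemma card_rV : #|{: 'rV[F]_n.+1}| = (4 ^ n.+1)%N.
Proof. by rewrite card_mx cardF mul1n. Qed.

Lemma sum_shift u (G : 'rV[F]_n.+1 -> rat) :
  \sum_w \sum_c G (w + c *: u) = 4 * \sum_w G w.
Proof.
rewrite exchange_big /= (eq_bigr (fun=> \sum_w G w)) => [|c _].
  by rewrite sumr_const cardF mulr_natl.
by rewrite [RHS](reindex_inj (addIr (c *: u))).
Qed.

Lemma chi_shift v w c : f v v = 0 ->
  chi (w + c *: v) = chi w * sgF (c * f v w + (c * f v w) ^+ 2).
Proof.
move=> fvv; rewrite /chi herm_self_shift !hermZl hermZr fvv !mulr0 addr0.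
by rewrite sgFD ?herm_idem ?F4_trace_idem.
Qed.

(** Along a line in the direction [v], [G] is constant and [chi] varies by the factor in
    [chi_shift]. This factor sums to 0 unless [w] is orthogonal to [v], and then [G] vanishes. *)
Lemma sum_chi_eq0 v (G : 'rV[F]_n.+1 -> rat) :
    f v v = 0 -> (forall w c, G (w + c *: v) = G w) ->
    (forall w, f w v = 0 -> G w = 0) ->
  \sum_w chi w * G w = 0.
Proof.
move=> fvv Gv G0; apply: (@mulfI _ 4) => //; rewrite mulr0 -(sum_shift v).
apply: big1 => w _; under eq_bigr => c _ do rewrite Gv chi_shift // -mulrA mulrCA.
rewrite -mulr_suml; have [fwv|fwv] := eqVneq (f w v) 0.
  by rewrite G0 // !mulr0.
by rewrite sum_sgF_trace ?mul0r // hermC0.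
Qed.

Lemma sum_isotropic v (G : 'rV[F]_n.+1 -> rat) :
    f v v = 0 -> (forall w c, G (w + c *: v) = G w) ->
    (forall w, f w v = 0 -> G w = 0) ->
  2 * \sum_w (f w w == 0)%:R * G w = \sum_w G w.
Proof.
move=> fvv Gv G0; rewrite mulr_sumr; under eq_bigr => w _ do
  rewrite mulrA isotropic_indicator mulrDl mul1r.
by rewrite big_split /= (sum_chi_eq0 fvv Gv G0) addr0.
Qed.

(** Each line in the direction [u] meets the hyperplane orthogonal to [v] in exactly one vector. *)
Lemma sum_kernel v u (G : 'rV[F]_n.+1 -> rat) :
    f u v != 0 -> (forall w c, G (w + c *: u) = G w) ->
  4 * \sum_w (f w v == 0)%:R * G w = \sum_w G w.
Proof.
move=> fuv Gu; rewrite -(sum_shift u); apply: eq_bigr => w _.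
under eq_bigr => c _ do rewrite Gu hermDl hermZl.
rewrite -mulr_suml (bigD1 (- f w v / f u v)) //= mulfVK // subrr eqxx.
rewrite big1 ?addr0 ?mul1r // => c cN.
rewrite addr_eq0 -eqr_oppLR; case: eqP => // e; case/eqP: cN.
by rewrite e mulfK.
Qed.

(** * Counting for a nondegenerate form *)

Hypothesis f_nondeg : nondegenerate f.

Lemma nondegenerate_ex v : v != 0 -> exists u, f u v != 0.
Proof.
move=> v0; have : v \notin orthov f fullv by rewrite (eqP f_nondeg) memv0.
by case/mem_orthovPn => u _; exists u; rewrite hermC0.
Qed.

Lemma nonproportional_ex v v' : v' != 0 -> (forall a, v != a *: v') ->
  exists2 u, f u v != 0 & f u v' = 0.
Proof.
move=> v'0 vv'; have [y fy] := nondegenerate_ex v'0.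
(* The exponent 2 below undoes the conjugation in the second argument: [f x (v - a ^+ 2 *: v')] is
   [f x v - a * f x v'], which is also the value of the form at [v] once [x] has been corrected by a
   multiple of [y]. *)
pose a := f y v / f y v'.
have: v - a ^+ 2 *: v' != 0 by rewrite subr_eq0.
case/nondegenerate_ex => x; rewrite hermBr hermZr -exprM F4_expr4.
move=> fx; exists (x - (f x v' / f y v') *: y).
  rewrite hermDl -scaleNr hermZl; apply: contra fx => /eqP fx.
  by rewrite -fx /a; apply/eqP; field.
by rewrite hermDl -scaleNr hermZl mulNr mulfVK // subrr.
Qed.

Let K : rat := 4 ^+ n.+1.

Lemma sum1_rV : \sum_(w : 'rV[F]_n.+1) (1 : rat) = K.
Proof. by rewrite sumr_const card_rV natrX. Qed.

Lemma sum_ker1 v : v != 0 -> 4 * \sum_w (f w v == 0)%:R = K.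
Proof.
move=> /nondegenerate_ex[u fu]; rewrite -sum1_rV -(sum_kernel (G := fun=> 1) fu) //.
by congr (_ * _); apply: eq_bigr => w _; rewrite mulr1.
Qed.

Lemma sum_ker2 v v' : v' != 0 -> (forall a, v != a *: v') ->
  16 * \sum_w (f w v == 0)%:R * (f w v' == 0)%:R = K.
Proof.
move=> v'0 vv'; have [u fu fu'] := nonproportional_ex v'0 vv'.
rewrite -(sum_ker1 v'0) -(sum_kernel (G := fun w => (f w v' == 0)%:R) fu).
  by ring.
by move=> w c; rewrite hermDl hermZl fu' mulr0 addr0.
Qed.

(** Three quarters of the space are not orthogonal to [v], and by [sum_isotropic] half of these
    vectors are isotropic. *)
Lemma sum_degree v : v != 0 -> f v v = 0 ->
  8 * \sum_w (f w w == 0)%:R * (f w v != 0)%:R = 3 * K.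
Proof.
move=> v0 fvv; have e := sum_isotropic (v := v) (G := fun w => (f w v != 0)%:R) fvv.
rewrite (_ : 8 = 4 * 2) // -mulrA {}e; first 1 last.
- by move=> w c; rewrite hermDl hermZl fvv mulr0 addr0.
- by move=> w ->; rewrite eqxx.
under eq_bigr => w _ do rewrite natr_negb.
by rewrite big_split /= sum1_rV sumrN mulrBr sum_ker1 //; ring.
Qed.

(** As [v] and [v'] are orthogonal, the product is constant along the direction [v], so half of the
    vectors it counts are isotropic. Two independent linear forms are both nonzero on 9/16 of the
    space. *)
Lemma sum_mu v v' : v != 0 -> v' != 0 -> f v v = 0 -> f v v' = 0 ->
    (forall a, v != a *: v') ->
  32 * \sum_w (f w w == 0)%:R * ((f w v != 0)%:R * (f w v' != 0)%:R) = 9 * K.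
Proof.
move=> v0 v'0 fvv fvv' vv'.
have e := sum_isotropic (v := v) (G := fun w => (f w v != 0)%:R * (f w v' != 0)%:R) fvv.
rewrite (_ : 32 = 16 * 2) // -mulrA {}e; first 1 last.
- by move=> w c; rewrite !hermDl !hermZl fvv fvv' !mulr0 !addr0.
- by move=> w ->; rewrite eqxx mul0r.
under eq_bigr => w _ do
  rewrite !natr_negb mulrBl mul1r mulrBr mulr1 opprB.
rewrite !big_split /= sum1_rV !sumrN.
have := sum_ker2 v'0 vv'; have := sum_ker1 v0; have := sum_ker1 v'0; lra.
Qed.

Lemma sum_chi_ker v : f v v = 0 -> \sum_w chi w * (f w v == 0)%:R = \sum_w chi w.
Proof.
move=> fvv; have e := sum_chi_eq0 (v := v) (G := fun w => (f w v != 0)%:R) fvv.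
under eq_bigr => w _ do rewrite -[(_ == 0)%:R](subKr 1) -natr_negb mulrBr mulr1.
rewrite big_split /= sumrN e ?subr0 // => [w c|w ->]; last by rewrite eqxx.
by rewrite hermDl hermZl fvv mulr0 addr0.
Qed.

(** On the hyperplane orthogonal to [v], translation by multiples of [v] preserves [chi] while
    [f w v'] runs through all values. *)
Lemma sum_chi_ker2 v v' : f v v = 0 -> f v v' != 0 ->
  4 * \sum_w chi w * ((f w v == 0)%:R * (f w v' == 0)%:R) = \sum_w chi w.
Proof.
move=> fvv fvv'; rewrite -(sum_chi_ker fvv).
rewrite -(sum_kernel (G := fun w => chi w * (f w v == 0)%:R) fvv').
  by congr (_ * _); apply: eq_bigr => w _; ring.
move=> w c; rewrite hermDl hermZl fvv mulr0 addr0 chi_shift //.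
have [fwv|_] := eqVneq (f w v) 0; last by rewrite !mulr0.
by rewrite hermC4 fwv !expr0n mulr0 expr0n addr0 /sgF eqxx mulr1.
Qed.

(** Here the product is not constant along [v], so all indicators are expanded. The part without
    [chi] yields [9 * K]; the part with [chi] is [S - S - S + S / 4], where [S] is the sum of
    [chi]. *)
Lemma sum_lambda v v' : f v v = 0 -> f v' v' = 0 -> f v v' != 0 ->
  32 * \sum_w (f w w == 0)%:R * ((f w v != 0)%:R * (f w v' != 0)%:R) =
  9 * K - 12 * \sum_w chi w.
Proof.
move=> fvv fv'v' fvv'.
have v0 : v != 0 by apply: contraNneq fvv' => ->; rewrite herm0l.
have v'0 : v' != 0 by apply: contraNneq fvv' => ->; rewrite herm0r.
have vv' a : v != a *: v'.
  by apply: contraNneq fvv' => ->; rewrite hermZl fv'v' mulr0.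
rewrite (_ : 32 = 16 * 2) // -mulrA mulr_sumr.
under eq_bigr => w _ do rewrite mulrA isotropic_indicator
  !natr_negb mulrDl mul1r [(1 - _) * _]mulrBl mul1r mulrBr mulr1
  opprB [chi _ * _]mulrDr !mulrBr mulr1.
rewrite !big_split /= sum1_rV !sumrN.
have := sum_ker2 v'0 vv'; have := sum_ker1 v0; have := sum_ker1 v'0.
have := sum_chi_ker fvv; have := sum_chi_ker fv'v'; have := sum_chi_ker2 fvv fvv'.
lra.
Qed.


(** This is the evaluation of a Gauss sum. Writing the second variable as [z + x] turns the product
    of characters into [chi z] times an additive character in [x], which is trivial only for
    [z = 0]. *)
Lemma sum_chi_sqr : (\sum_w chi w) ^+ 2 = K.
Proof.
have step z : \sum_x chi x * chi (z + x) =
    chi z * \sum_x sgF (f x z + f x z ^+ 2).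
  rewrite mulr_sumr; apply: eq_bigr => x _.
  rewrite /chi herm_self_shift sgFD ?F4_trace_idem ?F4_sqrD ?herm_idem //.
  rewrite [sgF (f z z + _)]sgFD ?herm_idem //.
  have sg1 : sgF (f x x) ^+ 2 = 1 by rewrite /sgF; case: eqP.
  by rewrite -[RHS]mul1r -sg1; ring.
rewrite expr2 mulr_suml.
under eq_bigr => x _ do
  rewrite mulr_sumr (reindex_inj (addIr x)) /=.
rewrite exchange_big /=; under eq_bigr => z _ do rewrite step.
rewrite (bigD1 0) //= [X in _ + X]big1 ?addr0 => [|z z0]; last first.
  have [u fu] := nondegenerate_ex z0.
  apply: (@mulfI _ 4) => //; rewrite mulrCA -(sum_shift u) mulr0.
  rewrite big1 ?mulr0 // => x _.
  under eq_bigr => c _ do rewrite hermDl hermZl F4_sqrD addrACA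
    sgFD ?F4_trace_idem //.
  by rewrite -mulr_sumr sum_sgF_trace ?mulr0.
rewrite /chi herm0l /sgF eqxx mul1r -sum1_rV; apply: eq_bigr => x _.
by rewrite herm0r expr0n addr0 eqxx.
Qed.

(** * Isotropic points and their common neighbors *)

Definition isotropic_vectors := [set w | (w != 0) && (f w w == 0)].

(** The index depends only on the support of [w], so that the pivot scales with [w] and can single
    out one vector per point. The default 0 occurs only for [w = 0]. *)
Definition pivot w : F := if [pick j | w 0 j != 0] is Some j then w 0 j else 0.

Lemma pivotZ a w : a != 0 -> pivot (a *: w) = a * pivot w.
Proof.
move=> a0; rewrite /pivot (eq_pick (Q := fun j => w 0 j != 0)) => [|j].
  by case: pickP => [j|]; rewrite ?mxE ?mulr0.
by rewrite !mxE mulf_eq0 (negPf a0).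
Qed.

Lemma pivot_eq0 w : (pivot w == 0) = (w == 0).
Proof.
rewrite /pivot; case: pickP => [j wj|w0].
  by rewrite (negPf wj); apply/esym/negP => /eqP w0; rewrite w0 mxE eqxx in wj.
rewrite eqxx; apply/esym/eqP/rowP => j; rewrite mxE.
by have /negbFE/eqP := w0 j.
Qed.

(** For each of the three nonzero [a], scaling by [a] is a bijection from the isotropic vectors of
    pivot 1 to those of pivot [a]. *)
Lemma dvd3_card_isotropic : (3 %| #|isotropic_vectors|)%N.
Proof.
pose X1 := [set w in isotropic_vectors | pivot w == 1].
suff -> : #|isotropic_vectors| = (3 * #|X1|)%N by rewrite dvdn_mulr.
rewrite -sum1_card (partition_big pivot (fun a => a != 0)) /=; last first.
  by move=> w; rewrite inE pivot_eq0 => /andP[].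
rewrite (eq_bigr (fun=> #|X1|)) => [|a a0].
  rewrite sum_nat_const; congr (_ * _)%N.
  by rewrite -[#|_|]/#|predC1 (0 : F)| cardC1 cardF.
rewrite sum1_card /X1 -[RHS](card_imset _ (scalerI a0)).
apply: eq_card => w; apply/andP/imsetP => [[]|[{}w + ->]].
  rewrite inE => /andP[w0 fw] /eqP wa; exists (a^-1 *: w).
    rewrite !inE scaler_eq0 invr_eq0 (negPf a0) w0 hermZZ ?invr_eq0 // fw /=.
    by rewrite pivotZ ?invr_eq0 // wa mulVf.
  by rewrite scalerA mulfV // scale1r.
rewrite !inE => /andP[/andP[w0 fw] /eqP w1].
by rewrite scaler_eq0 (negPf a0) w0 hermZZ // fw pivotZ // w1 mulr1.
Qed.

(** The added 1 accounts for the zero vector. *)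
Lemma card_isotropic : 2 * (#|isotropic_vectors|%:R + 1) = K + \sum_w chi w.
Proof.
rewrite -sum1_rV -big_split /=.
under [RHS]eq_bigr => w _ do rewrite -isotropic_indicator.
rewrite -mulr_sumr; congr (_ * _); rewrite (bigD1 0) //= herm0l eqxx addrC.
congr (_ + _); rewrite -sum1_card natr_sum big_mkcond [RHS]big_mkcond /=.
by apply: eq_bigr => w _; rewrite inE; do 2 case: eqP.
Qed.

Lemma pow2N_mod3 k : exists z : int, (-2) ^+ k = 1 + 3 * z.
Proof.
elim: k => [|k [z IHz]]; first by exists 0.
by exists (- 1 - 2 * z); rewrite exprS IHz; ring.
Qed.

(* The nonzero isotropic vectors come in triples, which fixes the sign of the
   sum, as it is congruent to 1 modulo 3. *)
Lemma sum_chiE : \sum_w chi w = (- 2) ^+ n.+1.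
Proof.
have := sum_chi_sqr; rewrite /K (_ : 4 = (- 2) ^+ 2) // exprAC => /eqP.
rewrite eqf_sqr => /orP[] /eqP // S_neg.
have := card_isotropic; rewrite S_neg /K (_ : 4 = (- 2) ^+ 2) // exprAC.
have /dvdnP[t ->] := dvd3_card_isotropic.
rewrite (_ : -2 = (-2 : int)%:~R) // -!rmorphXn /= => eq_rat.
have : (2 * ((t * 3)%:Z + 1))%:~R = (((-2) ^+ n.+1) ^+ 2 - (-2) ^+ n.+1)%:~R :> rat.
  by rewrite [RHS]rmorphB /= -eq_rat rmorphM !rmorphD /=.
move/intr_inj; have [z ->] := pow2N_mod3 n.+1; lia.
Qed.

Definition proportional v v' := [exists a : F, v == a *: v'].

(** Proportional, orthogonal and non-orthogonal pairs are handled by [sum_degree], [sum_mu] and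
    [sum_lambda]; the values are [24 * rho ^+ 2], [18 * rho ^+ 2] and [18 * rho ^+ 2 - 3 * rho]. *)
Lemma sum_common_neighbors (rho : rat) v v' :
    K = 64 * rho ^+ 2 -> \sum_w chi w = 8 * rho ->
    v \in isotropic_vectors -> v' \in isotropic_vectors ->
  \sum_(w in isotropic_vectors) (f w v != 0)%:R * (f w v' != 0)%:R =
  18 * rho ^+ 2 + 6 * rho ^+ 2 * (proportional v v')%:R
    - 3 * rho * (f v v' != 0)%:R.
Proof.
move=> eK eS; rewrite !inE => /andP[v0 /eqP fvv] /andP[v'0 /eqP fv'v'].
rewrite big_mkcond /= (eq_bigr (fun w =>
    (f w w == 0)%:R * ((f w v != 0)%:R * (f w v' != 0)%:R))) => [|w _]; last first.
  rewrite inE; have [->|_] := eqVneq w 0; last by case: eqP; rewrite ?mul1r ?mul0r.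
  by rewrite !herm0l !eqxx mul0r mulr0.
have [/existsP[a /eqP va]|/existsPn vv'] := boolP (proportional v v').
  have a0 : a != 0 by apply: contraNneq v0 => a0; rewrite va a0 scale0r.
  rewrite va hermZ_eq0l // fv'v' eqxx mulr0 subr0.
  under eq_bigr => w _ do rewrite hermZ_eq0r // -natrM mulnb andbb.
  by have := sum_degree v'0 fv'v'; rewrite eK /=; lra.
have [fvv'|fvv'] := eqVneq (f v v') 0.
  by have := sum_mu v0 v'0 fvv fvv' vv'; rewrite eK /=; lra.
by have := sum_lambda fvv fv'v' fvv'; rewrite eK eS /=; lra.
Qed.

Lemma sum_degree_isotropic (rho : rat) v :
    K = 64 * rho ^+ 2 -> v \in isotropic_vectors ->
  \sum_(w in isotropic_vectors) (f w v != 0)%:R = 24 * rho ^+ 2.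
Proof.
move=> eK; rewrite inE => /andP[v0 /eqP fvv].
rewrite big_mkcond /= (eq_bigr (fun w => (f w w == 0)%:R * (f w v != 0)%:R)).
  by have := sum_degree v0 fvv; rewrite eK; lra.
move=> w _; rewrite inE; have [->|_] := eqVneq w 0; first by rewrite !herm0l eqxx mulr0.
by case: eqP; rewrite ?mul1r ?mul0r.
Qed.

(** The count in [sum_degree] is nonzero. Such a [u] serves to tell transvections apart. *)
Lemma isotropic_neighbor v : v \in isotropic_vectors ->
  exists2 u, u \in isotropic_vectors & f u v != 0.
Proof.
rewrite inE => /andP[v0 /eqP fvv].
have : \sum_w (f w w == 0)%:R * (f w v != 0)%:R != 0 :> rat.
  apply/eqP => e; have := sum_degree v0 fvv; rewrite e mulr0.
  by move/esym/eqP; rewrite mulf_eq0 /= expf_eq0.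
case: (pickP (fun u => (f u u == 0) && (f u v != 0))) => [u /andP[fuu fuv] _|no_u].
  exists u => //; rewrite inE fuu andbT.
  by apply: contraNneq fuv => ->; rewrite herm0l.
rewrite big1 ?eqxx // => w _; have := no_u w.
by case: (_ == 0) => //=; [move->; rewrite mulr0 | rewrite mul0r].
Qed.

Lemma proportionalE v v' : v \in isotropic_vectors ->
  proportional v v' -> exists2 a, a != 0 & v = a *: v'.
Proof.
rewrite inE => /andP[v0 _] /existsP[a /eqP va]; exists a => //.
by apply: contraNneq v0 => a0; rewrite va a0 scale0r.
Qed.

End HermitianF4.

(** * Relations between involutions *)

Section GroupLemmas.

Local Open Scope group_scope.
Variable gT : finGroupType.
Implicit Types x y z : gT.

Lemma expg2_3_eq1 x : x ^+ 2 = 1 -> x ^+ 3 = 1 -> x = 1.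
Proof. by move=> x2; rewrite expgS x2 mulg1. Qed.

Lemma invol_commute_mul x y :
  x ^+ 2 = 1 -> y ^+ 2 = 1 -> commute x y -> (x * y) ^+ 2 = 1.
Proof. by move=> x2 y2 xy; rewrite expgMn // x2 y2 mulg1. Qed.

(** [x * y * x] is a conjugate of [y], and the braid relation makes [(x * y) ^+ 3] its square. *)
Lemma invol_braid_mul3 x y : x ^+ 2 = 1 -> y ^+ 2 = 1 ->
  x * y * x = y * x * y -> (x * y) ^+ 3 = 1.
Proof.
move=> x2 y2 braid; have -> : (x * y) ^+ 3 = x * y * x * (y * x * y).
  by rewrite !expgS expg0 mulg1 !mulgA.
have xV : x = x^-1 by apply: (mulgI x); rewrite mulgV -x2 expgS expg1.
have xyx : x * y * x = y ^ x by rewrite conjgE {1}xV mulgA.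
by rewrite -braid xyx -{2}[y ^ x]expg1 -expgS -conjXg y2 conj1g.
Qed.

(** This separates elements of one coset of the center that have a common neighbor [y], both in
    [G / N] and in [H]. *)
Lemma central_mul_invol_eq1 x y z :
    x ^+ 2 = 1 -> (x * z) ^+ 2 = 1 -> (x * y) ^+ 3 = 1 -> (x * z * y) ^+ 3 = 1 ->
    commute z x -> commute z y -> z = 1.
Proof.
move=> x2 xz2 xy3 xzy3 zx zy; apply: expg2_3_eq1.
  by rewrite -xz2 expgMn ?x2 ?mul1g //; apply: commute_sym.
rewrite -xzy3 -mulgA zy mulgA expgMn ?xy3 ?mul1g //.
by apply: commute_sym; apply: commuteM.
Qed.

(** [x] inverts [x * y], so an [x * y] centralized by [x] is its own inverse. *)
Lemma invol_mul_commute x y :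
  x ^+ 2 = 1 -> y ^+ 2 = 1 -> commute (x * y) x -> (x * y) ^+ 2 = 1.
Proof.
rewrite !expgS !expg0 !mulg1 => x2 y2 xyx.
by rewrite mulgA xyx !mulgA x2 mul1g.
Qed.

End GroupLemmas.

(* An abstract class E of involutions t v, indexed redundantly by the elements v
   of X, up to the relation p, and with the braid relation encoded by r. *)
Section Labelling.

Local Open Scope group_scope.
Variables (gT hT : finGroupType) (V : finType).
Variables (G N : {group gT}) (D : {set gT}) (q : nat).
Variables (H : {group hT}) (E : {set hT}).
Variables (X : {set V}) (t : V -> hT) (r p : rel V).

Hypothesis GD : three_transposition_group G D.
Hypothesis nsNG : N <| G.
Hypothesis N2 : 2%N.-group N.
Hypothesis card_fiber : {in D, forall x, #|D :&: (x *: N)| = q}.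
Hypothesis ctype : same_central_type (G / N)%G (D / N) H E.
Hypothesis EP : forall g, reflect (exists2 v, v \in X & g = t v) (g \in E).
Hypothesis nEZ : E \subset 'N('Z(H)).
Hypothesis t_sqr : {in X, forall v, t v ^+ 2 = 1}.
Hypothesis t_commute : {in X &, forall v w, ~~ r v w -> commute (t v) (t w)}.
Hypothesis t_braid : {in X &, forall v w,
  r v w -> t v * t w * t v = t w * t v * t w}.
Hypothesis t_eq : {in X &, forall v w, t v = t w <-> p v w}.
Hypothesis r_irr : {in X &, forall v w, r v w -> ~~ p v w}.
Hypothesis r_neighbor : {in X, forall v, exists2 w, w \in X & r v w}.

(** A label of [x] is a [v] such that [x] and [t v] have the same image in [H / 'Z(H)]. Adjacency is
    recovered from these images by playing squares against cubes. *)
Lemma central_quotient_labelling :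
  exists vv : gT -> V,
    [/\ {in D, forall x, vv x \in X},
        {in D &, forall x y, diagram x y = r (vv x) (vv y)}
      & {in X, forall w, #|[set x in D | p (vv x) w]| = q}].
Proof.
have [_ genD D2 Dord] := GD.
have sDG : D \subset G by rewrite -genD subset_gen.
have [phi [isoPhi phiD]] := ctype.
have /isomP[/injmP injPhi imPhi] := isoPhi.
have nNG : G \subset 'N(N) by case/andP: nsNG.
have nZG : (G / N)%G \subset 'N('Z((G / N)%G)) by apply: gFnorm.
pose Pi x := phi (coset 'Z((G / N)%G) (coset N x)).
have inGN x : x \in G -> coset N x \in (G / N)%G.
  by move=> xG; apply: mem_quotient.
have inGNZ x : x \in G -> coset 'Z((G / N)%G) (coset N x) \in (G / N)%G / 'Z((G / N)%G).
  by move=> xG; apply: mem_quotient; apply: inGN.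
have cosM x y : x \in G -> y \in G -> coset N (x * y) = coset N x * coset N y.
  by move=> xG yG; rewrite morphM ?(subsetP nNG).
have PiM x y : x \in G -> y \in G -> Pi (x * y) = Pi x * Pi y.
  move=> xG yG; rewrite /Pi cosM // morphM ?(subsetP nZG) ?inGN //.
  by rewrite morphM ?inGNZ.
have PiX x k : x \in G -> Pi (x ^+ k) = Pi x ^+ k.
  move=> xG; rewrite /Pi morphX ?(subsetP nNG) // morphX ?(subsetP nZG) ?inGN //.
  by rewrite morphX ?inGNZ.
have Pi_inj x y : x \in G -> y \in G -> Pi x = Pi y ->
    exists2 z, z \in 'Z((G / N)%G) & coset N y = coset N x * z.
  move=> xG yG /(injPhi _ _ (inGNZ _ xG) (inGNZ _ yG)) e.
  exists ((coset N x)^-1 * coset N y); last by rewrite mulKVg.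
  apply: coset_idr; first by rewrite groupM ?groupV ?(subsetP nZG) ?inGN.
  by rewrite morphM ?morphV ?groupV ?(subsetP nZG) ?inGN //= e mulVg.
have inD x : x \in D -> x \in G by apply: (subsetP sDG).
have PiD x : x \in D -> exists2 v, v \in X & Pi x = coset 'Z(H) (t v).
  move=> xD; have: Pi x \in E / 'Z(H).
    rewrite -phiD; apply: mem_morphim; first exact/inGNZ/inD.
    apply: mem_morphim; first by rewrite (subsetP nZG) ?inGN ?inD.
    by apply: mem_morphim; rewrite ?(subsetP nNG) ?inD.
  by case/morphimP=> g _ /EP[v vX ->] ->; exists v.
have DPi v : v \in X -> exists2 x, x \in D & Pi x = coset 'Z(H) (t v).
  move=> vX; have tE : t v \in E by apply/EP; exists v.
  have: coset 'Z(H) (t v) \in E / 'Z(H).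
    by apply: mem_morphim; rewrite ?(subsetP nEZ).
  rewrite -phiD => /morphimP[_ _ /morphimP[_ _ /morphimP[x _ xD ->] ->] ->].
  by exists x.
(* Modulo the center, [E] is the image of [D] and thus lies in the image of [phi], which is
   [H / 'Z(H)]. *)
have sEH : E \subset H.
  rewrite -(quotientSGK nEZ (center_sub H)) -imPhi -phiD.
  by apply: morphimS; apply: quotientS; apply: quotientS.
have tH v : v \in X -> t v \in H.
  by move=> vX; apply: (subsetP sEH); apply/EP; exists v.
have tN v : v \in X -> t v \in 'N('Z(H)).
  by move=> vX; apply: (subsetP nEZ); apply/EP; exists v.
have D2' x : x \in D -> x ^+ 2 = 1 by move=> xD; rewrite -(D2 x xD) expg_order.
have centH z v : z \in 'Z(H) -> v \in X -> commute z (t v).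
  by move=> /centerP[_ zH] vX; apply: zH; apply: tH.
have diagP x y v w : x \in D -> y \in D -> v \in X -> w \in X ->
    Pi x = coset 'Z(H) (t v) -> Pi y = coset 'Z(H) (t w) ->
  diagram x y = r v w.
  move=> xD yD vX wX Pix Piy.
  have xG := inD x xD; have yG := inD y yD.
  have Pixy k : Pi ((x * y) ^+ k) = coset 'Z(H) ((t v * t w) ^+ k).
    rewrite PiX ?groupM // PiM // Pix Piy -morphM ?tN //.
    by rewrite -morphX ?groupM ?tN.
  have Pi1 : Pi 1 = 1 by rewrite /Pi !morph1.
  apply/idP/idP => [/eqP xy3|rvw].
    (* If [t v] and [t w] commuted, the square and the cube of [x * y] would become trivial in
       [H / 'Z(H)], so [x * y] would be central modulo [N]. Commuting there with [x], it would have
       trivial square and cube modulo [N], and so lie in the 2-group [N] although its order is 3. *)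
    apply: contraT => nr; have stw := t_commute vX wX nr.
    have := Pixy 2; rewrite (invol_commute_mul (t_sqr vX) (t_sqr wX) stw).
    rewrite morph1 PiX ?groupM //.
    move=> Pixy2; have := PiX (x * y) 3 (groupM xG yG).
    have xyc : (x * y) ^+ 3 = 1 by rewrite -xy3 expg_order.
    rewrite xyc Pi1 => /esym Pixy3.
    have := expg2_3_eq1 Pixy2 Pixy3; rewrite -Pi1.
    move/esym/(Pi_inj _ _ (group1 G) (groupM xG yG)) => [z zZ].
    rewrite morph1 mul1g cosM // => xyz.
    have c2 u : u \in D -> coset N u ^+ 2 = 1.
      by move=> uD; rewrite -morphX ?(subsetP nNG) ?inD // D2' ?morph1.
    have xy2 : (coset N x * coset N y) ^+ 2 = 1.
      apply: invol_mul_commute; rewrite ?c2 // xyz.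
      by have [_ zG] := centerP _ _ zZ; apply: zG; apply: inGN.
    have xy1 : coset N (x * y) = 1.
      apply: expg2_3_eq1; first by rewrite cosM.
      by rewrite -morphX ?(subsetP nNG) ?groupM // xyc morph1.
    have xyN : x * y \in N by apply: coset_idr xy1; rewrite (subsetP nNG) ?groupM.
    by have := mem_p_elt N2 xyN; rewrite /p_elt xy3.
  (* Otherwise [(x * y) ^+ 2 = 1], so [(t v * t w) ^+ 2] is central. Having trivial cube,
     [t v * t w] is the inverse of its square, hence central, hence trivial, contrary to [r_irr]. *)
  have xyO := Dord x y xD yD.
  apply: contraT => xyN3; have xy2 : (x * y) ^+ 2 = 1.
    move: xyO xyN3; rewrite /diagram !inE => /or3P[/eqP o|/eqP o|->//] _.
      by apply/eqP; rewrite -order_dvdn o.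
    by rewrite -o expg_order.
  have := Pixy 2; rewrite xy2 Pi1 => /esym st2.
  have st2Z : (t v * t w) ^+ 2 \in 'Z(H).
    by apply: coset_idr st2; rewrite groupX ?groupM ?tN.
  have st3 : (t v * t w) ^+ 3 = 1.
    by apply: invol_braid_mul3; rewrite ?t_sqr //; apply: t_braid.
  have stV : t v * t w = ((t v * t w) ^+ 2)^-1.
    by apply: (mulIg ((t v * t w) ^+ 2)); rewrite mulVg -expgS.
  have st1 : t v * t w = 1.
    apply: expg2_3_eq1 => //; apply: invol_mul_commute; rewrite ?t_sqr //.
    by rewrite {1}stV; apply: centH; rewrite ?groupV.
  have : t v = t w.
    apply: (mulIg (t w)); rewrite st1; have := t_sqr wX.
    by rewrite expgS expg1 => ->.
  by move/(t_eq vX wX); rewrite (negPf (r_irr vX wX rvw)).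
have diag3 x y : diagram x y -> (x * y) ^+ 3 = 1.
  by move/eqP=> o; rewrite -o expg_order.
(* The cosets of [x] and [y] differ by a central [z], which is trivial because [u] is adjacent to
   both. *)
have PiN x y : x \in D -> y \in D -> Pi x = Pi y -> y \in x *: N.
  move=> xD yD Pixy; have xG := inD x xD; have yG := inD y yD.
  have [v vX Pix] := PiD x xD; have [w wX rvw] := r_neighbor vX.
  have [u uD Piu] := DPi w wX; have uG := inD u uD.
  have /diag3 xu3 : diagram x u by rewrite (diagP x u v w).
  have /diag3 yu3 : diagram y u by rewrite (diagP y u v w) -?Pixy.
  have [z zZ yz] := Pi_inj x y xG yG Pixy.
  have cX k a : a \in G -> coset N (a ^+ k) = coset N a ^+ k.
    by move=> aG; rewrite morphX ?(subsetP nNG).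
  have [_ zC] := centerP _ _ zZ.
  have z1 : z = 1.
    apply: (@central_mul_invol_eq1 _ (coset N x) (coset N u)).
    - by rewrite -cX // D2' // morph1.
    - by rewrite -yz -cX // D2' // morph1.
    - by rewrite -cosM // -cX ?groupM // xu3 morph1.
    - by rewrite -yz -cosM // -cX ?groupM // yu3 morph1.
    - by apply: zC; apply: inGN.
    - by apply: zC; apply: inGN.
  rewrite mem_lcoset; apply: coset_idr; first by rewrite (subsetP nNG) ?groupM ?groupV.
  by rewrite cosM ?groupV // morphV ?(subsetP nNG) // yz z1 mulg1 mulVg.
(* The same argument in [H]: since [v] and [w] both label [x], they share the neighbor [w']. *)
have Pit x v w : x \in D -> v \in X -> w \in X -> Pi x = coset 'Z(H) (t v) ->
    Pi x = coset 'Z(H) (t w) -> p v w.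
  move=> xD vX wX Pixv Pixw; apply/(t_eq vX wX).
  have [w' w'X rww'] := r_neighbor wX; have [u uD Piu] := DPi w' w'X.
  have rvw' : r v w' by rewrite -(diagP x u v w') // (diagP x u w w').
  have tvw : coset 'Z(H) ((t v)^-1 * t w) = 1.
    by rewrite morphM ?groupV ?tN // morphV ?tN //= -Pixv -Pixw mulVg.
  have zZ : (t v)^-1 * t w \in 'Z(H).
    by apply: coset_idr tvw; rewrite groupM ?groupV ?tN.
  have st3 a : a \in X -> r a w' -> (t a * t w') ^+ 3 = 1.
    by move=> aX raw'; apply: invol_braid_mul3; rewrite ?t_sqr //; apply: t_braid.
  have z1 : (t v)^-1 * t w = 1.
    apply: (@central_mul_invol_eq1 _ (t v) (t w'));
      by rewrite ?mulKVg ?t_sqr ?st3 //; apply: centH.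
  by rewrite -[RHS](mulKVg (t v)) z1 mulg1.
(* Only a default value for [vv]; it exists because the class [D] is nonempty. *)
have [v0 _] : exists v0 : V, True.
  have [x0 x0G Dx0] := imsetP (let: And4 D_class _ _ _ := GD in D_class).
  by have [|v _ _] := PiD x0; [rewrite Dx0 class_refl | exists v].
pose vv x := odflt v0 [pick v in X | Pi x == coset 'Z(H) (t v)].
have vvP x : x \in D -> vv x \in X /\ Pi x = coset 'Z(H) (t (vv x)).
  move=> xD; rewrite /vv; case: pickP => [v /andP[vX /eqP //]|no_v].
  by have [v vX Pix] := PiD x xD; have := no_v v; rewrite /= vX Pix eqxx.
exists vv; split=> [x xD|x y xD yD|w wX]; first by have [] := vvP x xD.
  by have [? ?] := vvP x xD; have [? ?] := vvP y yD; apply: diagP.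
(* The fiber over [w] is the part of [D] in the coset of [N] containing any one [x0] above [t w]. *)
have [x0 x0D Pix0] := DPi w wX.
rewrite -(card_fiber x0D); apply: eq_card => x; rewrite !inE.
have [xD|//] := boolP (x \in D); have [vX Pix] := vvP x xD.
apply/idP/idP => /= [/(t_eq vX wX) txw|xx0].
  by apply: PiN; rewrite // Pix0 Pix txw.
apply: (Pit x) => //; rewrite -Pix0 /Pi; congr (phi (coset _ _)).
move: xx0; rewrite mem_lcoset => /coset_id.
have xG := inD x xD; have x0G := inD x0 x0D.
rewrite cosM ?groupV // morphV ?(subsetP nNG) //= => x0x1.
by rewrite -[LHS](mulKVg (coset N x0)) x0x1 mulg1.
Qed.

End Labelling.

(** * Unitary transvections *)

Section Transvections.

Variables (F : finFieldType) (cardF : #|F| = 4%N) (m : nat).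
Variable f : {hermitian 'rV[F]_m.-1.+1 for false & conj4 cardF}.
Hypothesis f_nondeg : nondegenerate f.


Implicit Types (u v w x y : 'rV[F]_m.-1.+1).

Local Notation X := (isotropic_vectors f).
Local Notation E := (unitary_transvections f).

Definition transvection_mx v : 'M[F]_m.-1.+1 :=
  1%:M + (\col_i f 'e_i v) *m v.

Lemma transvection_mxE v x : x *m transvection_mx v = x + f x v *: v.
Proof.
rewrite mulmxDr mulmx1 mulmxA; congr (_ + _).
rewrite [x *m _]mx11_scalar mul_scalar_mx; congr (_ *: _).
rewrite {2}(row_sum_delta x).
rewrite (big_morph (f^~ v) (fun a b => hermDl f a b v) (herm0l f v)) mxE.
by apply: eq_bigr => i _; rewrite hermZl mxE.
Qed.

Lemma mulmx_inj p q (A B : 'M[F]_(p, q)) :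
  (forall x : 'rV_p, x *m A = x *m B) -> A = B.
Proof. by move=> AB; apply/row_matrixP => i; rewrite !rowE. Qed.

Lemma transvection_mx_sqr v : f v v = 0 ->
  transvection_mx v *m transvection_mx v = 1%:M.
Proof.
move=> fvv; apply: mulmx_inj => x; rewrite mulmxA !transvection_mxE mulmx1.
by rewrite hermDl hermZl fvv mulr0 addr0 -addrA -scalerDl F4_addrr // scale0r addr0.
Qed.

(** For isotropic [v] the matrix is its own inverse, so the default 1 is not taken on
    [isotropic_vectors]. *)
Definition transvection v : {'GL_m[F]} :=
  if @idP (transvection_mx v \is a GRing.unit) is ReflectT v_unit
  then FinRing.Unit v_unit else 1%g.

Lemma transvectionE v x : v \in X ->
  x *m GLval (transvection v) = x + f x v *: v.
Proof.
rewrite inE => /andP[_ /eqP fvv].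
rewrite -transvection_mxE; congr (_ *m _); rewrite /transvection.
by case: {-}_ / idP => // -[]; have [] := mulmx1_unit (transvection_mx_sqr fvv).
Qed.

Lemma GL_inj (g h : {'GL_m[F]}) :
  (forall x, x *m GLval g = x *m GLval h) -> g = h.
Proof. by move=> gh; apply: val_inj; apply: mulmx_inj. Qed.

Lemma transvectionP (g : {'GL_m[F]}) :
  reflect (exists2 v, v \in X & g = transvection v) (g \in E).
Proof.
rewrite inE; apply: (iffP existsP) => [[v /and3P[v0 fvv /forallP gv]]|[v vX ->]].
  have vX : v \in X by rewrite inE v0.
  by exists v => //; apply: GL_inj => x; rewrite transvectionE //; apply/eqP.
exists v; move: (vX); rewrite inE => /andP[-> ->].
by apply/forallP => x; rewrite transvectionE.
Qed.

Lemma transvection_sqr v : v \in X -> (transvection v ^+ 2 = 1)%g.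
Proof.
move=> vX; apply: GL_inj => x; rewrite expgS expg1 GL_MxE mulmxA !transvectionE //.
move: vX; rewrite inE => /andP[_ /eqP fvv]; rewrite GL_1E mulmx1.
by rewrite hermDl hermZl fvv mulr0 addr0 -addrA -scalerDl F4_addrr // scale0r addr0.
Qed.

(** Scaling [v] by [a] multiplies [f x v *: v] by [a ^+ 3 = 1]. *)
Lemma transvection_proportional v w : v \in X -> w \in X ->
  proportional v w -> transvection v = transvection w.
Proof.
move=> vX wX /(proportionalE vX)[a a0 va]; apply: GL_inj => x.
rewrite !transvectionE // va hermZr scalerA mulrAC -exprSr F4_expr3 //.
by rewrite mul1r.
Qed.

Lemma transvection_inj v w : v \in X -> w \in X ->
  transvection v = transvection w -> proportional v w.
Proof.
move=> vX wX vw; have [u _ fu] := isotropic_neighbor f_nondeg vX.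
have := transvectionE u vX; rewrite vw transvectionE // => /addrI e.
apply/existsP; exists ((f u v)^-1 * f u w).
by rewrite -scalerA e scalerA mulVf // scale1r.
Qed.

Lemma transvection_commute v w : v \in X -> w \in X -> f v w = 0 ->
  commute (transvection v) (transvection w).
Proof.
move=> vX wX fvw; apply: GL_inj => x; rewrite !GL_MxE !mulmxA !transvectionE //.
have fwv : f w v = 0 by apply/eqP; rewrite hermC0 fvw.
by rewrite !hermDl !hermZl fvw fwv !mulr0 !addr0 addrAC.
Qed.

Lemma transvection_braid v w : v \in X -> w \in X -> f v w != 0 ->
  (transvection v * transvection w * transvection v =
   transvection w * transvection v * transvection w)%g.
Proof.
(* The image computed in [half] is symmetric in [u] and [u']. *)
move=> vX wX; have half u u' y : u \in X -> u' \in X -> f u u' != 0 ->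
    y *m GLval (transvection u * transvection u' * transvection u)%g =
    y + (f y u' + f y u * f u u') *: u' + (f y u + f y u' * f u' u) *: u.
  move=> uX u'X fuu'; rewrite !GL_MxE !mulmxA !transvectionE //.
  move: uX; rewrite inE => /andP[_ /eqP fuu].
  rewrite !hermDl !hermZl fuu mulr0 addr0 mulrDl -mulrA (hermC4 f u' u) -exprS.
  rewrite F4_expr3 // mulr1 -!addrA; congr (_ + _).
  rewrite [LHS]addrC -addrA -scalerDl; congr (_ + _ *: _).
  by rewrite [_ + f y u]addrC !addrA F4_addrr // add0r addrC.
move=> fvw; apply: GL_inj => x; rewrite !half // ?[f w v == 0]hermC0 // addrAC.
by [].
Qed.

Lemma transvection_isometry v x y : v \in X ->
  f (x *m GLval (transvection v)) (y *m GLval (transvection v)) = f x y.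
Proof.
move=> vX; rewrite !transvectionE //.
move: vX; rewrite inE => /andP[_ /eqP fvv].
rewrite hermDl !hermDr !hermZl !hermZr fvv !mulr0 addr0 -(hermC4 f v y).
by rewrite [f v y * _]mulrC -addrA F4_addrr // addr0.
Qed.

Lemma transvection_SU v : v \in X -> transvection v \in SU f.
Proof.
move=> vX; rewrite inE; apply/andP; split.
  have: \det (GLval (transvection v)) ^+ 2 = 1.
    have /(congr1 (fun g => \det (GLval g))) := transvection_sqr vX.
    by rewrite expgS expg1 GL_MxE det_mulmx GL_1E det1 -expr2.
  (* In characteristic 2 the root -1 equals 1. *)
  move/eqP; rewrite sqrf_eq1 => /orP[] // /eqP->.
  by rewrite -subr_eq0 -opprD F4_addrr // oppr0.
apply/forallP => x; apply/forallP => y.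
by rewrite transvection_isometry.
Qed.

(** [SU f] contains the transvections and normalizes its derived subgroup, hence also the center of
    that subgroup, which is characteristic in it. *)
Lemma transvections_sub_norm : E \subset 'N('Z((SU_group f)^`(1)))%g.
Proof.
apply/subsetP => _ /transvectionP[v vX ->].
have: SU f \subset 'N('Z((SU_group f)^`(1)))%g.
  exact: gFnorm_trans (der_norm 1 (SU_group f)).
by move/subsetP; apply; apply: transvection_SU.
Qed.

Lemma type_4h_SU_labelling (h : nat) (gT : finGroupType) (G : {group gT})
    (D : {set gT}) :
    three_transposition_group G D -> type_4h_SU f h G D ->
  exists vv : gT -> 'rV[F]_m.-1.+1,
    [/\ {in D, forall x : gT, vv x \in X},
        {in D &, forall x y : gT, diagram x y = (f (vv x) (vv y) != 0)}
      & {in X, forall w, #|[set x : gT in D | proportional (vv x) w]| = (4 ^ h)%N}].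
Proof.
move=> GD [N [nsNG N2 cardN ctype]].
apply: (central_quotient_labelling (r := fun v w => f v w != 0) GD nsNG N2 cardN
  ctype (@transvectionP) transvections_sub_norm transvection_sqr).
- by move=> v w vX wX /negbNE/eqP; apply: transvection_commute.
- by move=> v w vX wX; apply: transvection_braid.
- move=> v w vX wX; split; first exact: transvection_inj.
  exact: transvection_proportional.
- move=> v w vX wX; apply: contra => /(proportionalE vX)[a a0 ->].
  by move: wX; rewrite inE hermZ_eq0l // => /andP[].
- move=> v /(isotropic_neighbor f_nondeg)[u uX fuv]; exists u => //.
  by rewrite hermC0.
Qed.

End Transvections.

(** * Spectra of rational symmetric matrices *)

Section Spectrum.

Lemma char_poly_conj (R : comUnitRingType) n (P A : 'M[R]_n) : P \in unitmx ->
  char_poly (invmx P *m A *m P) = char_poly A.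
Proof.
move=> Pu; rewrite /char_poly; pose pC := map_mx (@polyC R).
have -> : char_poly_mx (invmx P *m A *m P) =
    pC _ _ (invmx P) *m char_poly_mx A *m pC _ _ P.
  rewrite /char_poly_mx mulmxBr mulmxBl !map_mxM /=; congr (_ - _).
  by rewrite scalar_mxC -mulmxA -map_mxM /= mulVmx // map_mx1 mulmx1.
rewrite !det_mulmx mulrAC -det_mulmx -map_mxM /= mulVmx //.
by rewrite map_mx1 det1 mul1r.
Qed.

Lemma spectrumP n (A : 'M[algC]_n) (s : seq algC) :
  char_poly A = \prod_(z <- s) ('X - z%:P) -> perm_eq (spectrum A) s.
Proof.
move=> Es; apply: prod_XsubC_eq; rewrite -Es /spectrum.
case: closed_field_poly_normal => r /= Er.
by rewrite [RHS]Er (eqP (char_poly_monic A)) scale1r.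
Qed.

Lemma spectrum_eigenvalue n (A : 'M[algC]_n) z :
  z \in spectrum A -> eigenvalue A z.
Proof.
rewrite eigenvalue_root_char /spectrum.
case: closed_field_poly_normal => r /= ->.
by rewrite (eqP (char_poly_monic A)) scale1r root_prod_XsubC.
Qed.

(** By the spectral theorem [A] is conjugate to a diagonal matrix, and traces of powers are
    invariant under conjugation. *)
Lemma spectrum_real_symmetric n (A : 'M[algC]_n) :
    A^T = A -> A \is a mxOver Num.real ->
  [/\ size (spectrum A) = n,
      \sum_(z <- spectrum A) z = \tr A,
      \sum_(z <- spectrum A) z ^+ 2 = \tr (A *m A)
    & \sum_(z <- spectrum A) z ^+ 3 = \tr (A *m A *m A)].
Proof.
move=> Asym Areal.
have /orthomx_spectralP : A \is normalmx.
  apply: symmetric_normalmx => //; apply/is_hermitianmxP.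
  by rewrite expr0 scale1r map_mx_id // Asym.
set P := spectralmx A; set d := spectral_diag A => ->.
have Pu : P \in unitmx := spectral_unit A.
pose s := [seq d 0 i | i : 'I_n].
have /spectrumP eq_s : char_poly (invmx P *m diag_mx d *m P) =
    \prod_(z <- s) ('X - z%:P).
  rewrite char_poly_conj // char_poly_trig ?diag_mx_is_trig // big_image /=.
  by apply: eq_bigr => i _; rewrite mxE eqxx.
have conjM (B C : 'M_n) : invmx P *m B *m P *m (invmx P *m C *m P) =
    invmx P *m (B *m C) *m P.
  by rewrite -!mulmxA (mulmxA P (invmx P)) mulmxV // mul1mx.
have conj_tr (B : 'M_n) : \tr (invmx P *m B *m P) = \tr B.
  by rewrite mxtrace_mulC mulmxA mulmxV // mul1mx.
rewrite (perm_size eq_s) !(perm_big s eq_s) /= !conjM !conj_tr.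
rewrite !mulmx_diag !mxtrace_diag !big_image /=.
split; first by rewrite size_map -cardE card_ord.
- by [].
- by apply: eq_bigr => i _; rewrite mxE expr2.
- by apply: eq_bigr => i _; rewrite !mxE !exprS expr0 mulr1 mulrA.
Qed.

Lemma perm_flatten_nseq (T : eqType) (s t : seq T) :
    uniq t -> {subset s <= t} ->
  perm_eq s (flatten [seq nseq (count_mem y s) y | y <- t]).
Proof.
move=> t_uniq s_sub; apply/allP => x _ /=; apply/eqP.
rewrite count_flatten -map_comp sumnE big_map.
have [xt|xNt] := boolP (x \in t).
  rewrite (bigD1_seq x) //= count_nseq /= eqxx mul1n big1 ?addn0 // => y yx.
  by rewrite count_nseq /= (negPf yx) mul0n.
rewrite (count_memPn _); last exact: contra (s_sub x) xNt.
rewrite big_seq big1 // => y yt; rewrite /= count_nseq /=.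
by case: eqP yt => [->|_ _]; [rewrite (negPf xNt) | rewrite mul0n].
Qed.

Lemma sum_count_mem (T : eqType) (R : nmodType) (g : T -> R) (s t : seq T) :
    uniq t -> {subset s <= t} ->
  \sum_(z <- s) g z = \sum_(y <- t) g y *+ count_mem y s.
Proof.
move=> t_uniq s_sub; rewrite (perm_big _ (perm_flatten_nseq t_uniq s_sub)) /=.
rewrite big_flatten big_map; apply: eq_bigr => y _.
by rewrite big_nseq iter_addr_0.
Qed.

Local Notation R := (ratr : {rmorphism rat -> algC}).

(** Members of [t] may have multiplicity 0. The trace identities descend to the rationals because
    [ratr] is injective. *)
Lemma spectrum_rat_symmetric n (B : 'M[rat]_n) (t : seq rat) :
    B^T = B -> uniq t ->
    (forall z, eigenvalue (map_mx R B) z -> z \in map R t) ->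
  exists c : rat -> nat,
    [/\ perm_eq (spectrum (map_mx R B)) (flatten [seq nseq (c y) (R y) | y <- t]),
        (\sum_(y <- t) c y)%N = n,
        \sum_(y <- t) y * (c y)%:R = \tr B,
        \sum_(y <- t) y ^+ 2 * (c y)%:R = \tr (B *m B)
      & \sum_(y <- t) y ^+ 3 * (c y)%:R = \tr (B *m B *m B)].
Proof.
move=> Bsym t_uniq t_sub.
have Asym : (map_mx R B)^T = map_mx R B by rewrite map_trmx Bsym.
have Areal : map_mx R B \is a mxOver Num.real.
  by apply/mxOverP => i j; rewrite mxE; apply: Creal_Crat; apply: Crat_rat.
have [sz s1 s2 s3] := spectrum_real_symmetric Asym Areal.
have Rt_uniq : uniq (map R t) by rewrite (map_inj_uniq (fmorph_inj R)).
have s_sub : {subset spectrum (map_mx R B) <= map R t}.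
  by move=> z /spectrum_eigenvalue; apply: t_sub.
have perm_s := perm_flatten_nseq Rt_uniq s_sub.
exists (fun y => count_mem (R y) (spectrum (map_mx R B))).
have sum_t i : R (\sum_(y <- t) y ^+ i * (count_mem (R y) (spectrum (map_mx R B)))%:R) =
    \sum_(z <- spectrum (map_mx R B)) z ^+ i.
  rewrite (sum_count_mem _ Rt_uniq s_sub) big_map rmorph_sum.
  by apply: eq_bigr => y _; rewrite mulr_natr rmorphMn rmorphXn.
split.
- by apply: perm_trans perm_s _; rewrite -map_comp.
- rewrite -[RHS]sz (perm_size perm_s) size_flatten /shape -!map_comp sumnE big_map.
  by apply: eq_bigr => y _ /=; rewrite size_nseq.
- apply: (fmorph_inj R); rewrite -trace_map_mx -s1 -(eq_bigr _ (fun z _ => expr1 z)).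
  by rewrite -sum_t; congr (R _); apply: eq_bigr => y _; rewrite expr1.
- by apply: (fmorph_inj R); rewrite -trace_map_mx map_mxM -s2.
- by apply: (fmorph_inj R); rewrite -trace_map_mx !map_mxM -s3.
Qed.

(** A row eigenvector not orthogonal to the all-ones column has eigenvalue [k]. Any other is killed
    by the constant matrix, so that [z] is a root of [z * (z - a) * (z + 2 * a)]. *)
Lemma eigenvalue_of_cubic n (B : 'M[rat]_n) (k a b : rat) z :
    (forall i, \sum_j B i j = k) ->
    B *m B *m B = (2 * a ^+ 2) *: B - a *: (B *m B) + const_mx b ->
  eigenvalue (map_mx R B) z -> z \in map R [:: k; a; - (2 * a); 0].
Proof.
move=> B_row B3 /eigenvalueP[v]; set A := map_mx R B => vA v0.
have A1 : A *m const_mx 1 = R k *: (const_mx 1 : 'cV_n).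
  apply/colP => i; rewrite !mxE mulr1 -(B_row i) rmorph_sum.
  by apply: eq_bigr => j _; rewrite !mxE mulr1.
have [v1|v1] := eqVneq (v *m (const_mx 1 : 'cV_n)) 0; last first.
  have : (z - R k) *: (v *m (const_mx 1 : 'cV_n)) = 0.
    by rewrite scalerBl scalemxAl -vA -mulmxA A1 -scalemxAr subrr.
  move/eqP; rewrite scaler_eq0 (negPf v1) orbF subr_eq0 => /eqP->.
  by rewrite mem_head.
have vb : v *m (const_mx (R b) : 'M_n) = 0.
  have -> : const_mx (R b) = (const_mx 1 : 'cV_n) *m const_mx (R b) :> 'M[algC]_n.
    by apply/matrixP => i j; rewrite !mxE big_ord1 !mxE mul1r.
  by rewrite mulmxA v1 mul0mx.
have A3 : A *m A *m A = R (2 * a ^+ 2) *: A - R a *: (A *m A) + const_mx (R b).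
  by rewrite -!map_mxM B3 map_mxD map_mxB !map_mxZ map_const_mx.
have := congr1 (mulmx v) A3; rewrite mulmxDr mulmxBr vb addr0.
rewrite -!scalemxAr !mulmxA !(vA, =^~ scalemxAl) !scalerA => /eqP.
rewrite -scalerBl -subr_eq0 -scalerBl scaler_eq0 (negPf v0) orbF.
rewrite rmorphM rmorphXn rmorph_nat.
have -> : z * z * z - (2 * R a ^+ 2 * z - R a * (z * z)) =
  z * (z - R a) * (z + 2 * R a) by ring.
rewrite !mulf_eq0 -orbA subr_eq0 addr_eq0 !inE rmorphN rmorphM rmorph_nat rmorph0.
by case/or3P=> ->; rewrite ?orbT.
Qed.

Lemma spectrum_rat_symmetric4 n (B : 'M[rat]_n) (k r s : rat) :
    B^T = B -> uniq [:: k; r; - s; 0] ->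
    (forall z, eigenvalue (map_mx R B) z -> z \in map R [:: k; r; - s; 0]) ->
  exists x y z o : nat,
    [/\ perm_eq (spectrum (map_mx R B))
          (nseq x (R k) ++ nseq y (R r) ++ nseq z (R (- s)) ++ nseq o 0),
        (x + y + z + o)%N = n,
        k * x%:R + r * y%:R - s * z%:R = \tr B,
        k ^+ 2 * x%:R + r ^+ 2 * y%:R + s ^+ 2 * z%:R = \tr (B *m B)
      & k ^+ 3 * x%:R + r ^+ 3 * y%:R - s ^+ 3 * z%:R = \tr (B *m B *m B)].
Proof.
move=> Bsym t_uniq t_sub.
have [c [perm_s]] := spectrum_rat_symmetric Bsym t_uniq t_sub.
rewrite !big_cons !big_nil !expr0n !mul0r !addr0 !addn0 !addnA !addrA.
rewrite sqrrN [(- s) ^+ 3]exprNn -signr_odd expr1 mulN1r !mulNr => size_s E1 E2 E3.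
exists (c k), (c r), (c (- s)), (c 0); split=> //.
by move: perm_s; rewrite /= cats0 rmorph0.
Qed.

(* The eigenvalues other than the degree are the roots [rho * q], [-2 * rho * q]
   and [0] of the cubic, and the first three power sums determine the
   multiplicities [x], [y], [z]. *)
Lemma multiplicities (q rho n x y z : rat) :
    q != 0 -> 1 <= rho ^+ 2 -> 3 * n = q * (32 * rho ^+ 2 + 4 * rho - 1) ->
    8 * rho ^+ 2 * q * x + rho * q * y - 2 * (rho * q) * z = 0 ->
    (8 * rho ^+ 2 * q) ^+ 2 * x + (rho * q) ^+ 2 * y + (2 * (rho * q)) ^+ 2 * z =
      n * (8 * rho ^+ 2 * q) ->
    (8 * rho ^+ 2 * q) ^+ 3 * x + (rho * q) ^+ 3 * y - (2 * (rho * q)) ^+ 3 * z =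
      n * (48 * rho ^+ 4 * q ^+ 2) - (rho * q) * (n * (8 * rho ^+ 2 * q)) ->
  [/\ x = 1, 9 * y = 8 * (8 * rho ^+ 2 - 1 - 2 * rho)
    & 9 * z = 4 * (8 * rho ^+ 2 - 1 + 7 * rho)].
Proof.
move=> q0 rho1 n_eq E1 E2 E3.
have rho0 : rho != 0.
  by apply/eqP => e; move: rho1; rewrite e; lra.
have F1 : 8 * rho * x + y - 2 * z = 0.
  by apply: (@mulfI _ (rho * q)); [rewrite mulf_neq0 | lra].
have F2 : 3 * (64 * rho ^+ 2 * x + y + 4 * z) = 8 * (32 * rho ^+ 2 + 4 * rho - 1).
  apply: (@mulfI _ (rho ^+ 2 * q ^+ 2)); first by rewrite mulf_neq0 ?expf_neq0.
  have := congr1 (fun w => w * (8 * rho ^+ 2 * q)) n_eq; lra.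
have F3 : 3 * (512 * rho ^+ 3 * x + y - 8 * z) =
    8 * (32 * rho ^+ 2 + 4 * rho - 1) * (6 * rho - 1).
  apply: (@mulfI _ (rho ^+ 3 * q ^+ 3)); first by rewrite mulf_neq0 ?expf_neq0.
  have := congr1 (fun w => w * (8 * rho ^+ 3 * q ^+ 2 * (6 * rho - 1))) n_eq; lra.
have n0 : 32 * rho ^+ 2 + 4 * rho - 1 != 0.
  (* The difference of this polynomial and [(rho + 2) ^+ 2] is [31 * rho ^+ 2 - 5], which is
     positive. *)
  by apply: lt0r_neq0; have := sqr_ge0 (rho + 2); lra.
have x1 : x = 1.
  (* Adding [F2] and [F3] and eliminating [y] and [z] by [F1] gives this factor times [48 * (x - 1)]
     equal to 0. *)
  apply: (@mulfI _ (rho * (32 * rho ^+ 2 + 4 * rho - 1))); first by rewrite mulf_neq0.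
  lra.
by move: F1 F2; rewrite x1 => F1 F2; split; lra.
Qed.

Lemma spectrum_of_cubic n (B : 'M[rat]_n) (q rho : rat) :
    q != 0 -> 1 <= rho ^+ 2 -> B^T = B ->
    3 * n%:R = q * (32 * rho ^+ 2 + 4 * rho - 1) ->
    (forall i, \sum_j B i j = 8 * rho ^+ 2 * q) ->
    \tr B = 0 -> \tr (B *m B) = n%:R * (8 * rho ^+ 2 * q) ->
    B *m B *m B = (2 * (rho * q) ^+ 2) *: B - (rho * q) *: (B *m B) +
      const_mx (48 * rho ^+ 4 * q ^+ 2) ->
  exists d e c : nat,
    [/\ 9 * d%:R = 8 * (8 * rho ^+ 2 - 1 - 2 * rho),
        9 * e%:R = 4 * (8 * rho ^+ 2 - 1 + 7 * rho),
        (1 + d + e + c)%N = n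
      & perm_eq (spectrum (map_mx (ratr : rat -> algC) B))
          (ratr (8 * rho ^+ 2 * q) :: nseq d (ratr (rho * q)) ++
             nseq e (ratr (- (2 * (rho * q)))) ++ nseq c 0)].
Proof.
move=> q0 rho1 Bsym n_eq B_row B_tr B2_tr B3.
have rho0 : rho != 0 by apply/eqP => e; move: rho1; rewrite e; lra.
have B3_tr : \tr (B *m B *m B) =
    n%:R * (48 * rho ^+ 4 * q ^+ 2) - (rho * q) * (n%:R * (8 * rho ^+ 2 * q)).
  rewrite B3 -scaleNr !mxtraceD !mxtraceZ B_tr B2_tr mulr0 add0r mulNr addrC.
  congr (_ - _); rewrite /mxtrace; under eq_bigr do rewrite mxE.
  by rewrite sumr_const card_ord -[LHS]mulr_natl.
have ev z := eigenvalue_of_cubic (z := z) B_row B3.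
have t_uniq : uniq [:: 8 * rho ^+ 2 * q; rho * q; - (2 * (rho * q)); 0].
  (* Each difference of two listed values is [rho * q] times a factor that is constant or
     [8 * rho - x] with [x] small; the latter is nonzero as [8 * rho] has absolute value at least
     8. *)
  have ne (x y z : rat) : x - y = rho * q * z -> z != 0 -> x != y.
    by move=> e z0; rewrite -subr_eq0 e !mulf_neq0.
  have rho8 (x : rat) : x ^+ 2 < 64 -> 8 * rho - x != 0.
    move=> x64; apply/eqP => e; have ex : x = 8 * rho by lra.
    by move: x64 rho1; rewrite ex; lra.
  have n1 : 8 * rho ^+ 2 * q != rho * q.
    by apply: (ne _ _ (8 * rho - 1)); [ring | apply: rho8; lra].
  have n2 : 8 * rho ^+ 2 * q != - (2 * (rho * q)).
    by apply: (ne _ _ (8 * rho - (-2))); [ring | apply: rho8; lra].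
  have n3 : 8 * rho ^+ 2 * q != 0.
    by apply: (ne _ _ (8 * rho - 0)); [ring | apply: rho8; lra].
  have n4 : rho * q != - (2 * (rho * q)) by apply: (ne _ _ 3); [ring | lra].
  have n5 : rho * q != 0 by rewrite mulf_neq0.
  have n6 : - (2 * (rho * q)) != 0 by apply: (ne _ _ (-2)); [ring | lra].
  by rewrite !cons_uniq !inE !negb_or n1 n2 n3 n4 n5 n6.
have [a [d [e [c [perm_s size_s E1 E2 E3]]]]] := spectrum_rat_symmetric4 Bsym t_uniq ev.
rewrite B_tr in E1; rewrite B2_tr in E2; rewrite B3_tr in E3.
have [/eqP a1 d_eq e_eq] := multiplicities q0 rho1 n_eq E1 E2 E3.
move: a1; rewrite pnatr_eq1 => /eqP a1.
by exists d, e, c; split; [exact: d_eq | exact: e_eq | rewrite -a1 | move: perm_s; rewrite a1].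
Qed.

End Spectrum.

(** * The blow-up of the non-orthogonality graph on isotropic points *)

Section BlowUp.

Variables (F : finFieldType) (cardF : #|F| = 4%N) (n : nat).
Variable f : {hermitian 'rV[F]_n.+1 for false & conj4 cardF}.
Hypothesis f_nondeg : nondegenerate f.
Variables (T : finType) (D : {set T}) (vv : T -> 'rV[F]_n.+1) (q : nat).
Variable rho : rat.

Local Notation X := (isotropic_vectors f).

Hypothesis vvX : {in D, forall x : T, vv x \in X}.
Hypothesis card_vv :
  {in X, forall w, #|[set x : T in D | proportional (vv x) w]| = q}.
Lemma sum_proportional w : w \in X ->
  \sum_(x in D) (proportional (vv x) w)%:R = q%:R :> rat.
Proof.
move=> wX; rewrite -(card_vv wX) -sum1_card natr_sum big_mkcond [RHS]big_mkcond.
by apply: eq_bigr => x _; rewrite inE; case: (x \in D); case: proportional.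
Qed.

(** Double counting of the pairs of [x] in [D] and [w] proportional to [vv x]: each [x] occurs with
    three vectors, each isotropic [w] with [q] elements of [D]. *)
Lemma sum_labels (g : 'rV[F]_n.+1 -> rat) :
    (forall a w, a != 0 -> g (a *: w) = g w) ->
  3 * \sum_(x in D) g (vv x) = q%:R * \sum_(w in X) g w.
Proof.
move=> gZ.
have -> : q%:R * \sum_(w in X) g w =
    \sum_(w in X) \sum_(x in D | proportional (vv x) w) g w.
  rewrite mulr_sumr; apply: eq_bigr => w wX.
  rewrite -(sum_proportional wX) mulr_suml big_mkcondr.
  by apply: eq_bigr => x _; case: proportional; rewrite ?mul1r ?mul0r.
rewrite (exchange_big_dep (mem D)) /=; last by move=> ? ? _ /andP[].
rewrite mulr_sumr; apply: eq_bigr => x xD; have vX := vvX xD.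
rewrite (eq_bigl (mem [set a *: vv x | a in [set~ 0]])) => [|w]; last first.
  rewrite xD /=; apply/andP/imsetP => [[wX /(proportionalE vX)[a a0 va]]|].
    exists a^-1; first by rewrite !inE invr_eq0.
    by rewrite va scalerA mulVf // scale1r.
  move=> [a]; rewrite !inE => a0 ->; move: vX; rewrite inE => /andP[v0 fv].
  rewrite scaler_eq0 (negPf a0) v0 hermZZ // fv; split=> //.
  by apply/existsP; exists a^-1; rewrite scalerA mulVf // scale1r.
have vinj : {in [set~ 0] &, injective (fun a => a *: vv x)}.
  move=> a b _ _ /eqP; rewrite -subr_eq0 -scalerBl scaler_eq0 subr_eq0.
  by move: vX; rewrite inE => /andP[/negPf-> _]; rewrite orbF => /eqP.
rewrite big_imset //= (eq_bigr (fun=> g (vv x))) => [|a]; last first.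
  by rewrite !inE => /gZ.
by rewrite sumr_const cardsC1 cardF mulr_natl.
Qed.

Hypothesis q0 : (0 < q)%N.
Hypothesis rhoK : 4 ^+ n.+1 = 64 * rho ^+ 2.
Hypothesis rhoS : (- 2) ^+ n.+1 = 8 * rho.
Hypothesis rho1 : 1 <= rho ^+ 2.

Let S := sum_chiE f_nondeg.

Lemma card_labels : 3 * #|D|%:R = q%:R * (32 * rho ^+ 2 + 4 * rho - 1) :> rat.
Proof.
have := sum_labels (g := fun=> 1) (fun _ _ _ => erefl).
rewrite !sumr_const => ->; congr (_ * _).
by have := card_isotropic f; rewrite S rhoK rhoS; lra.
Qed.

Definition label_mx : 'M[rat]_#|D| :=
  \matrix_(i, j) (f (vv (enum_val i)) (vv (enum_val j)) != 0)%:R.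

Lemma label_mx_sym : label_mx^T = label_mx.
Proof. by apply/matrixP => i j; rewrite !mxE hermC0. Qed.

Lemma sum_label_degree x : x \in D ->
  \sum_(y in D) (f (vv x) (vv y) != 0)%:R = 8 * rho ^+ 2 * q%:R :> rat.
Proof.
move=> xD; have := sum_labels (g := fun w => (f (vv x) w != 0)%:R).
rewrite (eq_bigr (fun w => (f w (vv x) != 0)%:R)) => [|w _]; last by rewrite hermC0.
rewrite (sum_degree_isotropic f_nondeg rhoK (vvX xD)) => e.
have {}e := e (fun a w a0 => congr1 (fun b => (~~ b)%:R) (hermZ_eq0r f _ _ a0)).
lra.
Qed.

Lemma label_mx_row i : \sum_j label_mx i j = 8 * rho ^+ 2 * q%:R.
Proof.
under eq_bigr => j _ do rewrite mxE.
rewrite -(sum_label_degree (enum_valP i)).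
by rewrite (big_enum_val (fun y => (f (vv (enum_val i)) (vv y) != 0)%:R)).
Qed.

Lemma label_mx_tr : \tr label_mx = 0.
Proof.
apply: big1 => i _; rewrite mxE.
by have := vvX (enum_valP i); rewrite inE => /andP[_ ->].
Qed.

Lemma label_mx_sqr_tr : \tr (label_mx *m label_mx) = #|D|%:R * (8 * rho ^+ 2 * q%:R).
Proof.
rewrite /mxtrace (eq_bigr (fun=> 8 * rho ^+ 2 * q%:R)) => [|i _].
  by rewrite sumr_const card_ord -[LHS]mulr_natl.
rewrite mxE -(label_mx_row i); apply: eq_bigr => j _.
by rewrite !mxE [f _ (vv (enum_val i)) == 0]hermC0 -natrM mulnb andbb.
Qed.

(** The numbers in [sum_common_neighbors] get multiplied by [q / 3] in passing from vectors to
    elements of [D]. *)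
Lemma label_mx_sqrE i k : (label_mx *m label_mx) i k =
  q%:R * (6 * rho ^+ 2
    + 2 * rho ^+ 2 * (proportional (vv (enum_val k)) (vv (enum_val i)))%:R
    - rho * label_mx i k).
Proof.
set v := vv (enum_val k); set v' := vv (enum_val i).
have vX : v \in X := vvX (enum_valP k); have v'X : v' \in X := vvX (enum_valP i).
have := sum_labels (g := fun w => (f w v != 0)%:R * (f w v' != 0)%:R).
rewrite (sum_common_neighbors f_nondeg rhoK (etrans S rhoS) vX v'X) => e.
have {}e := e (fun a w a0 => congr2 (fun b c => (~~ b)%:R * (~~ c)%:R)
   (hermZ_eq0l f _ _ a0) (hermZ_eq0l f _ _ a0)).
rewrite !mxE -/v -/v' [f v' v == 0]hermC0.
under eq_bigr => j _ do rewrite !mxE -/v -/v' mulrC [f v' _ == 0]hermC0.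
rewrite -(big_enum_val (fun y => (f (vv y) v != 0)%:R * (f (vv y) v' != 0)%:R)) /=.
lra.
Qed.

(** The formula for the square is multiplied by [label_mx]. The constant term picks up the column
    sum, and the proportionality matrix acts as the scalar [q], since elements with proportional
    labels have equal rows. *)
Lemma label_mx_cube : label_mx *m label_mx *m label_mx =
  (2 * (rho * q%:R) ^+ 2) *: label_mx - (rho * q%:R) *: (label_mx *m label_mx) +
    const_mx (48 * rho ^+ 4 * q%:R ^+ 2).
Proof.
have entry (M M' : 'M[rat]_#|D|) a b c i k :
    (a *: M - b *: M' + const_mx c) i k = a * M i k - b * M' i k + c.
  by rewrite !mxE.
apply/matrixP => i k; rewrite entry mxE [(label_mx *m label_mx) i k]mxE.
under eq_bigr => j _ do rewrite label_mx_sqrE -mulrA mulrBl mulrDl -!mulrA.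
rewrite -mulr_sumr big_split big_split /= sumrN -!mulr_sumr.
have -> : \sum_j label_mx j k = 8 * rho ^+ 2 * q%:R.
  by rewrite -(label_mx_row k); apply: eq_bigr => j _; rewrite !mxE hermC0.
have -> : \sum_j (proportional (vv (enum_val j)) (vv (enum_val i)))%:R *
    label_mx j k = q%:R * label_mx i k.
  pose g y : rat := (proportional (vv y) (vv (enum_val i)))%:R * label_mx i k.
  rewrite -(sum_proportional (vvX (enum_valP i))) mulr_suml (big_enum_val g).
  apply: eq_bigr => j _; rewrite /g.
  case: (boolP (proportional _ _)) => [|_]; last by rewrite !mul0r.
  case/(proportionalE (vvX (enum_valP j))) => a a0 va.
  by rewrite !mxE va hermZ_eq0l.
ring.
Qed.

Lemma label_spectrum :
  exists d e c : nat,
    [/\ 9 * d%:R = 8 * (8 * rho ^+ 2 - 1 - 2 * rho),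
        9 * e%:R = 4 * (8 * rho ^+ 2 - 1 + 7 * rho),
        (1 + d + e + c)%N = #|D|
      & perm_eq (spectrum (map_mx (ratr : rat -> algC) label_mx))
          (ratr (8 * rho ^+ 2 * q%:R) :: nseq d (ratr (rho * q%:R)) ++
             nseq e (ratr (- (2 * (rho * q%:R)))) ++ nseq c 0)].
Proof.
have q_neq0 : q%:R != 0 :> rat by rewrite pnatr_eq0 -lt0n.
exact: (spectrum_of_cubic q_neq0 rho1 label_mx_sym card_labels label_mx_row
  label_mx_tr label_mx_sqr_tr label_mx_cube).
Qed.

End BlowUp.

(** * The parameters in terms of [h] and [m] *)

Lemma expr4_sqr (R : nzRingType) k : 4 ^+ k = ((- 2) ^+ k) ^+ 2 :> R.
Proof. by rewrite exprAC sqrrN -(natrX _ 2 2). Qed.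

Lemma expr2_even (R : nzRingType) k : 2 ^+ (2 * k) = ((- 2) ^+ k) ^+ 2 :> R.
Proof. by rewrite -expr4_sqr exprM -(natrX _ 2 2). Qed.

Theorem proposition6p11 (h m : nat) (hm : (3 <= m)%N)
    (F : finFieldType) (cardF : #|F| = 4%N)
    (f : {hermitian 'rV[F]_m.-1.+1 for false & conj4 cardF})
    (f_nondeg : nondegenerate f)
    (gT : finGroupType) (G : {group gT}) (D : {set gT})
    (GD : three_transposition_group G D)
    (typeGD : type_4h_SU f h G D) :
  (#|D|%:R : rat) =
    4 ^+ h * (2 ^+ (2 * m - 1) - 1 - (- 2) ^+ (m - 1)) / 3 /\
  {in D, forall x, diagram_degree D x = (2 ^ (2 * m - 3 + 2 * h))%N} /\
  exists d e c : nat,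
    [/\ (d%:R : rat) = 8 * (2 ^+ (2 * m - 3) - 1 - (- 2) ^+ (m - 2)) / 9,
        (e%:R : rat) = 4 * (2 ^+ (2 * m - 3) - 1 - 7 * (- 2) ^+ (m - 3)) / 9,
        (1 + d + e + c)%N = #|D|
      & perm_eq (spectrum (adjacency_mx D))
          (2 ^+ (2 * m - 3 + 2 * h)
           :: nseq d (- (- 2) ^+ (m - 3 + 2 * h))
           ++ nseq e (- (- 2) ^+ (m - 2 + 2 * h))
           ++ nseq c 0)].
Proof.
case: m hm f f_nondeg typeGD => [|[|[|k]]] // _ f f_nondeg typeGD.
have [vv [vvX diagE card_vv]] := type_4h_SU_labelling f_nondeg GD typeGD.
(* With [m = k + 3] this is [(- 2) ^+ m / 8], an eighth of the sum in [sum_chiE]. *)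
pose rho : rat := - (- 2) ^+ k.
have q0 : (0 < 4 ^ h)%N by rewrite expn_gt0.
have k3 : k.+3 = (k + 3)%N by rewrite addn3.
have rhoK : 4 ^+ k.+3 = 64 * rho ^+ 2 :> rat.
  by rewrite k3 exprD expr4_sqr /rho; ring.
have rhoS : (- 2) ^+ k.+3 = 8 * rho :> rat.
  by rewrite k3 exprD /rho; ring.
have rho1 : 1 <= rho ^+ 2.
  by rewrite sqrrN -expr4_sqr exprn_ege1.
have qE : (4 ^ h)%:R = 4 ^+ h :> rat by rewrite natrX.
have e3 : (2 * k.+3 - 3 = 2 * k + 3)%N by lia.
have k2 : 2 ^+ (2 * k + 3) = 8 * rho ^+ 2 :> rat.
  by rewrite exprD expr2_even /rho; ring.
have degE : 8 * rho ^+ 2 * (4 ^ h)%:R = 2 ^+ (2 * k.+3 - 3 + 2 * h) :> rat.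
  by rewrite e3 exprD k2 qE expr2_even -expr4_sqr.
have card_D := card_labels f_nondeg vvX card_vv rhoK rhoS.
have -> : adjacency_mx D = map_mx ratr (label_mx f D vv).
  apply/matrixP => i j; rewrite !mxE ratr_nat.
  by rewrite diagE ?enum_valP.
split; [|split].
- have -> : (2 * k.+3 - 1 = 2 * k + 5)%N by lia.
  apply: (@mulfI _ 3); first by [].
  rewrite card_D qE exprD expr2_even (_ : k.+3 - 1 = k + 2)%N; last by lia.
  rewrite exprD /rho.
  by field.
- move=> x xD; apply/eqP; rewrite -(eqr_nat rat) natrX -degE.
  rewrite -(sum_label_degree f_nondeg vvX card_vv rhoK xD) /diagram_degree.
  rewrite -sum1_card natr_sum big_mkcond [X in _ == X]big_mkcond /=.
  apply/eqP/eq_bigr => y _; rewrite inE; have [yD|//] := boolP (y \in D).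
  by rewrite andTb (diagE x y xD yD); case: (_ != 0).
have [d [e [c [dE eE cE perm_s]]]] :=
  label_spectrum f_nondeg vvX card_vv q0 rhoK rhoS rho1.
exists d, e, c; split=> [|||].
- apply: (@mulfI _ 9); first by [].
  have -> : (k.+3 - 2 = k + 1)%N by lia.
  rewrite dE e3 k2 exprD expr1 /rho; lra.
- apply: (@mulfI _ 9); first by [].
  have -> : (k.+3 - 3 = k)%N by lia.
  rewrite eE e3 k2 /rho; lra.
- exact: cE.
(* The factor [4 ^ h] is absorbed as [(- 2) ^+ (2 * h)], which leaves signs unchanged. *)
have sE : (- 2) ^+ (k.+3 - 3 + 2 * h) = - (rho * (4 ^ h)%:R) :> rat.
  have -> : (k.+3 - 3 = k)%N by lia.
  by rewrite exprD exprM sqrrN -natrX qE /rho mulNr opprK.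
have sE2 : (- 2) ^+ (k.+3 - 2 + 2 * h) = 2 * (rho * (4 ^ h)%:R) :> rat.
  have -> : (k.+3 - 2 + 2 * h = 1 + (k.+3 - 3 + 2 * h))%N by lia.
  by rewrite exprD sE expr1 mulNr mulrN opprK.
apply: perm_trans perm_s _.
rewrite degE -sE2 -[rho * _]opprK -sE !rmorphN !rmorphXn !rmorphN !rmorph_nat.
exact: perm_refl.
Qed.
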